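(* Let $a > 0$, $I_0 := [a, +\infty)$, $I_1 := (0, a]$, and let $S : \mathbb{R}^+ \to \mathbb{R}_0^+$ be a map that is piecewise $C^3$ with respect to the partition $\{I_0, I_1\}$ and satisfies the following hypotheses, where $\phi_j := (S|_{I_j})^{-1} : \mathbb{R}_0^+ \to I_j$ for $j \in \{0,1\}$: (H1) $S(I_0) = S(I_1) = \mathbb{R}_0^+$. (H2) $S'(x) > 1$ for all $x \in I_0$; $S'(x) \to 1$ as $x \to \infty$; $S'(x) < -1$ for all $x \in I_1$. Equivalently: (i) $\phi_0(0) = a$, $0 < \phi_0'(x) < 1$ for all $x \in \mathbb{R}_0^+$, and $\phi_0'(x) \to 1$ as $x \to \infty$; (ii) $\phi_1(0) = a$ and $-1 < \phi_1'(x) < 0$ for all $x \in \mathbb{R}_0^+$. (H3) $S$ preserves the Lebesgue measure; equivalently, $\phi_0'(x) - \phi_1'(x) = 1$ for all $x \in \mathbb{R}_0^+$. (H4) (i) $1 + 2\phi_1'(x) > 0$ for all $x \in \mathbb{R}^+$; (ii) $\phi_1''(x) - (\phi_1'(x))^2 > 0$ for all $x \in \mathbb{R}^+$; (iii) for every $x \in \mathbb{R}^+$ at least one of the following holds: (a) $\phi_1'''(x) + \phi_1''(x) > 0$ and $3\phi_1''(x) - (\phi_1'(x))^2 + \phi_1'(x) > 0$; or (b) $\phi_1'''(x) + \phi_1''(x) - (\phi_1'(x))^2 > 0$. For a function $g: \mathbb{R}^+ \to \mathbb{R}$ define $$(Lg)(x) = \phi_0'(x)\, g(\phi_0(x)) -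 \phi_1'(x)\, g(\phi_1(x)), \qquad x \in \mathbb{R}^+ .$$ Let $$\mathcal{F} := \left\{ g : \mathbb{R}^+ \to \mathbb{R} \,:\, g \in C^2,\ g > 0,\ g' < 0,\ g'' + g' < 0 \right\},$$ where the inequalities are pointwise on $\mathbb{R}^+$. Then $L(\mathcal{F}) \subset \mathcal{F}$.
   Context: $\mathbb{R}^+ = (0, +\infty)$ and $\mathbb{R}_0^+ = [0, +\infty)$. ''Piecewise $C^3$ with respect to the partition $\{I_0, I_1\}$'' means that the restrictions of $S$ to $I_0$ and to $I_1$ are each $C^3$, with derivatives at the common endpoint $a$ understood as one-sided derivatives from within each interval. The operator $L$ is the Perron-Frobenius operator of $S$, i.e. its transfer operator relative to the Lebesgue measure. *)

(* Defs.v *)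
From mathcomp Require Import all_boot all_order all_algebra.
From mathcomp Require Import all_classical all_reals all_analysis.
Import Order.TTheory GRing.Theory Num.Theory.
Import numFieldNormedType.Exports.

Local Open Scope classical_set_scope.
Local Open Scope ring_scope.

Set Implicit Arguments.
Unset Strict Implicit.
Unset Printing Implicit Defensive.

(* Derivative of f at x relative to D: the difference quotient only sees points
   of D, so that at an endpoint of an interval D it is the one-sided derivative
   from within D. *)
Definition derivable_on (R : realType) (D : set R) (f : R -> R) (x : R) : Prop :=
  cvg ((f y - f x) / (y - x) @[y --> within D x^']).

Definition derive_on (R : realType) (D : set R) (f : R -> R) (x : R) : R :=
  lim ((f y - f x) / (y - x) @[y --> within D x^']).

Definition derive_onn (R : realType) (n : nat) (D : set R) (f : R -> R) : R -> R :=
  iter n (derive_on D) f.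

Definition Cn_on (R : realType) (n : nat) (D : set R) (f : R -> R) : Prop :=
  (forall k : nat, (k < n)%N ->
     forall x : R, D x -> derivable_on D (derive_onn k D f) x) /\
  {within D, continuous (derive_onn n D f)}.

(* Functions on ]0, +oo[ are represented by total functions R -> R whose values
   elsewhere are irrelevant. *)
Definition Rpos (R : realType) : set R := `]0, +oo[%classic.
Definition Rnneg (R : realType) : set R := `[0, +oo[%classic.

Arguments Rpos R : clear implicits.
Arguments Rnneg R : clear implicits.

Definition I0 (R : realType) (a : R) : set R := `[a, +oo[%classic.
Definition I1 (R : realType) (a : R) : set R := `]0, a]%classic.

Definition phi0 (R : realType) (a : R) (S : R -> R) : R -> R := pinv (I0 a) S.
Definition phi1 (R : realType) (a : R) (S : R -> R) : R -> R := pinv (I1 a) S.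

Definition preserves_lebesgue (R : realType) (S : R -> R) : Prop :=
  forall A : set R, measurable A -> A `<=` Rnneg R ->
    lebesgue_measure (Rpos R `&` S @^-1` A) = lebesgue_measure A.

Definition transfer (R : realType) (a : R) (S : R -> R) (g : R -> R) (x : R) : R :=
  derive1 (phi0 a S) x * g (phi0 a S x) - derive1 (phi1 a S) x * g (phi1 a S x).

Definition classF (R : realType) : set (R -> R) :=
  [set g : R -> R | forall x : R, Rpos R x ->
     [/\ derivable g x 1, derivable (derive1 g) x 1 & {for x, continuous (derive1n 2 g)}] /\
     [/\ 0 < g x, derive1 g x < 0 & derive1n 2 g x + derive1 g x < 0]].

Arguments classF R : clear implicits.

(* Main.v *)
Require Import Defs.
From mathcomp Require Import all_boot all_order all_algebra.
From mathcomp Require Import all_classical all_reals all_analysis.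
From mathcomp Require Import ring lra.
Import Order.TTheory GRing.Theory Num.Theory.
Import numFieldNormedType.Exports.

(** Write u = - phi_1' and w = phi_1''.  Monotonicity of S on both branches
    gives S^-1([0, x]) = [phi_1(x), phi_0(x)], so preservation of the Lebesgue
    measure says phi_0(x) = x + phi_1(x) ([phi0_eq_add_phi1]).  Everything can
    therefore be expressed through phi_1 alone, and only the regularity of the
    decreasing branch matters: phi_1 is C^3 on the open half-line because S is
    C^3 with nonvanishing derivative on the interior of I_1
    ([Cn_open_inverse]), and then
      L g (x) = (1 - u) g(x + phi_1(x)) + u g(phi_1(x))
    is C^2 and positive.

    The sign conditions on L g are pointwise algebra.  Let g be in the class F,
    h = - g' > 0 and let the subscripts 0, 1 denote evaluation at phi_0(x) and
    phi_1(x); phi_1(x) < phi_0(x).  Since g and g + g' are strictly decreasing,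
    D = g_1 - g_0 is positive and D > h_1 - h_0.  Then
      (L g)' = - w D - (1 - u)^2 h_0 + u^2 h_1,
    and w > u^2 together with D > h_1 - h_0 bounds this above by
    - (1 - 2 u) h_0 < 0 ([transfer_deriv_lt0]).  For (L g)'' + (L g)', the
    inequality g'' < h gives, with z = phi_1''',
      (L g)'' + (L g)' < - (z + w) D - (3 (1 - u) w + u (1 - u)^2) h_0
                         - u (3 w - u^2 - u) h_1.
    Under alternative (a) every term is negative.  Under (b), replacing
    (z + w) D by u^2 (h_1 - h_0) and w by u^2 leaves multiples of h_0 and h_1
    which are negative because 0 < 2 u < 1 ([transfer_deriv2_lt0]). *)

Local Open Scope classical_set_scope.
Local Open Scope ring_scope.

Set Implicit Arguments.
Unset Strict Implicit.
Unset Printing Implicit Defensive.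

(** * Derivatives relative to a set *)

Lemma within_dnbhs_interior (R : realType) (D : set R) (x : R) :
  D° x -> within D x^' = x^'.
Proof.
move=> Dx; rewrite eqEsubset; split; last by move=> A; apply: filterS => y Ay _.
move=> A /= DA; change (\forall y \near x, D y) in Dx.
by apply: filterS2 Dx DA => y Dy DA xy; exact: DA.
Qed.

Lemma difference_quotient_shift (R : realType) (f : R -> R) (x : R) :
  (f y - f x) / (y - x) @[y --> x^'] = h^-1 *: (f (h + x) - f x) @[h --> 0^'].
Proof.
apply/funext => A; apply/propext.
change ((\forall y \near x, y != x -> A ((f y - f x) / (y - x))) <->
  (\forall h \near (0 : R), h != 0 -> A (h^-1 *: (f (h + x) - f x)))).
have E h : (f (x + h) - f x) / (x + h - x) = h^-1 *: (f (h + x) - f x).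
  by rewrite addrAC subrr add0r [x + h]addrC mulrC.
have E0 h : (x + h != x) = (h != 0) by rewrite -subr_eq0 addrAC subrr add0r.
split=> [/nbhs0P|hA]; last apply/nbhs0P; last move: hA;
  by apply: filterS => h /=; rewrite E E0.
Qed.

Lemma derivable_on_interior (R : realType) (D : set R) (f : R -> R) (x : R) :
  D° x -> derivable_on D f x <-> derivable f x 1.
Proof.
move=> Dx; rewrite /derivable_on (within_dnbhs_interior Dx).
rewrite difference_quotient_shift.
rewrite /derivable (_ : (fun h : R => h^-1 *: (f (h + x) - f x)) =
  (fun h : R => h^-1 *: ((f \o shift x) (h *: 1) - f x)))//.
by apply/funext => h /=; rewrite [h *: 1]mulr1.
Qed.

Lemma derive_on_interior (R : realType) (D : set R) (f : R -> R) (x : R) :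
  D° x -> derive_on D f x = derive1 f x.
Proof.
move=> Dx; rewrite /derive_on (within_dnbhs_interior Dx).
by rewrite difference_quotient_shift.
Qed.

Lemma derivable_on_continuous (R : realType) (D : set R) (f : R -> R) :
  (forall x, D x -> derivable_on D f x) -> {within D, continuous f}.
Proof.
move=> df; apply/subspace_continuousP => x Dx.
have [l fl] := (cvg_ex _).1 (df x Dx).
have : f x + (f y - f x) / (y - x) * (y - x) @[y --> within D x^'] --> f x.
  rewrite -[X in _ --> X]addr0 -(mulr0 l) -(subrr x).
  apply: cvgD; first exact: cvg_cst.
  apply: cvgM; first exact: fl.
  apply: cvgB; last exact: cvg_cst.
  apply: cvg_within_filter; exact: nbhs_dnbhs.
move=> + A Ax => /(_ A Ax) hA.
change (\forall y \near x, y != x -> D y ->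
  A (f x + (f y - f x) / (y - x) * (y - x))) in hA.
change (\forall y \near x, D y -> A (f y)).
move: hA; apply: filterS => y + Dy; have [->|yx] := eqVneq y x.
  by move=> _; exact: nbhs_singleton.
by move=> /(_ isT Dy); rewrite divfK ?subr_eq0// addrC subrK.
Qed.

(** * Functions of class C^n on an open set *)

Lemma eq_derive1_open (R : realType) (U : set R) (f g : R -> R) :
  open U -> (forall x, U x -> f x = g x) ->
  forall x, U x -> derive1 f x = derive1 g x.
Proof.
move=> oU fg x Ux; rewrite !derive1E; apply: near_eq_derive.
by have := open_nbhs_nbhs (conj oU Ux); apply: filterS.
Qed.

(** [f] is of class C^n on [U], by recursion on the derivative.  This is the
    intended notion only for open [U], where the two-sided derivatives at the
    points of [U] do not depend on the values of [f] outside [U]. *)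
Fixpoint Cn_open {R : realType} (n : nat) (U : set R) (f : R -> R) : Prop :=
  if n is m.+1 then
    (forall x, U x -> derivable f x 1) /\ Cn_open m U (derive1 f)
  else forall x, U x -> {for x, continuous f}.

Lemma derivable1_continuous (R : realType) (f : R -> R) (x : R) :
  derivable f x 1 -> {for x, continuous f}.
Proof. by move=> /derivable1_diffP/differentiable_continuous. Qed.

Section Cn_open_theory.
Variables (R : realType).
Implicit Types (U V : set R) (f g : R -> R) (n : nat).

Lemma eq_Cn_open n U f g : open U -> (forall x, U x -> f x = g x) ->
  Cn_open n U f -> Cn_open n U g.
Proof.
move=> oU; elim: n f g => [|n IH] f g fg /=.
  move=> cf x Ux; rewrite /prop_for/continuous_at -fg//.
  apply: cvg_trans (cf x Ux); apply: near_eq_cvg.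
  by have := open_nbhs_nbhs (conj oU Ux); apply: filterS.
move=> [df Cf]; split.
  move=> x Ux; apply: near_eq_derivable (df x Ux).
  by have := open_nbhs_nbhs (conj oU Ux); apply: filterS.
apply: IH Cf; exact: eq_derive1_open.
Qed.

Lemma Cn_openW n U f : Cn_open n.+1 U f -> Cn_open n U f.
Proof.
elim: n f => [|n IH] f [df Cf].
  by move=> x /df /derivable1_continuous.
by split => //; exact: IH.
Qed.

Lemma Cn_open_cst n U (c : R) : Cn_open n U (cst c).
Proof.
elim: n c => [|n IH] c; first by move=> x _; exact: cst_continuous.
split; first by move=> x _; exact: derivable_cst.
rewrite (_ : derive1 (cst c) = cst (0 : R))//.
by apply/funext => x; rewrite derive1_cst.
Qed.

Lemma Cn_open_id n U : Cn_open n U id.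
Proof.
case: n => [|n]; first by move=> x _; exact: cvg_id.
split; first by move=> x _; exact: derivable_id.
rewrite (_ : derive1 id = cst (1 : R)); first exact: Cn_open_cst.
by apply/funext => x; rewrite derive1E derive_id.
Qed.

Lemma Cn_openD n U f g : open U -> Cn_open n U f -> Cn_open n U g ->
  Cn_open n U (f \+ g).
Proof.
move=> oU; elim: n f g => [|n IH] f g.
  by move=> cf cg x Ux; apply: cvgD; [exact: cf|exact: cg].
move=> [df Cf] [dg Cg]; split.
  by move=> x Ux; apply: derivableD; [exact: df|exact: dg].
apply: eq_Cn_open (IH _ _ Cf Cg) => // x Ux.
by rewrite /= !derive1E deriveD//; [exact: df|exact: dg].
Qed.

Lemma Cn_openM n U f g : open U -> Cn_open n U f -> Cn_open n U g ->
  Cn_open n U (f \* g).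
Proof.
move=> oU; elim: n f g => [|n IH] f g.
  by move=> cf cg x Ux; apply: cvgM; [exact: cf|exact: cg].
move=> /[dup] /Cn_openW Cf0 [df Cf] /[dup] /Cn_openW Cg0 [dg Cg]; split.
  by move=> x Ux; apply: derivableM; [exact: df|exact: dg].
apply: eq_Cn_open (Cn_openD oU (IH _ _ Cf0 Cg) (IH _ _ Cf Cg0)) => // x Ux.
rewrite /= !derive1E deriveM//; [|exact: df|exact: dg].
by rewrite [g x *: _]mulrC.
Qed.

Lemma Cn_open_comp n U V f g : open U -> (forall x, U x -> V (f x)) ->
  Cn_open n U f -> Cn_open n V g -> Cn_open n U (g \o f).
Proof.
move=> oU UV; elim: n f g UV => [|n IH] f g UV.
  move=> cf cg x Ux; apply: continuous_comp; first exact: cf.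
  exact/cg/UV.
move=> /[dup] /Cn_openW Cf0 [df Cf] [dg Cg]; split.
  move=> x Ux; apply/derivable1_diffP/differentiable_comp.
    exact/derivable1_diffP/df.
  exact/derivable1_diffP/dg/UV.
apply: eq_Cn_open (Cn_openM oU (IH _ _ UV Cf0 Cg) Cf) => // x Ux.
by rewrite /= (derive1_comp (df _ Ux) (dg _ (UV _ Ux))).
Qed.

Lemma Cn_openV n U f : open U -> (forall x, U x -> f x != 0) ->
  Cn_open n U f -> Cn_open n U (fun x => (f x)^-1).
Proof.
move=> oU f0; elim: n => [|n IH].
  by move=> cf x Ux; apply: cvgV; [exact: f0|exact: cf].
move=> /[dup] /Cn_openW/IH Vf [df Cf]; split.
  by move=> x Ux; apply: derivableV; [exact: f0|exact: df].
have C1 := Cn_openM oU (Cn_open_cst n U (- 1)) (Cn_openM oU Vf Vf).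
apply: eq_Cn_open (Cn_openM oU C1 Cf) => // x Ux.
rewrite /= !derive1E deriveV//; [|exact: f0|exact: df].
by rewrite mulN1r -invfM -expr2.
Qed.

(** For n >= 1, the inverse of a C^n map with nonvanishing derivative is C^n:
    the relation phi' = (1 / f') o phi gains one order of regularity at each
    step. *)
Lemma Cn_open_inverse n U V f phi : open U -> open V ->
  (forall x, U x -> V (phi x)) -> (forall x, U x -> f (phi x) = x) ->
  (forall y, V y -> phi (f y) = y) -> (forall y, V y -> U (f y)) ->
  (forall y, V y -> (derive1 f y : R) != 0) ->
  Cn_open n.+1 V f -> Cn_open n.+1 U phi.
Proof.
move=> oU oV UV fK phiK VU f0 Cf.
have dphi x : U x -> is_derive x 1 phi (derive1 f (phi x) : R)^-1.
  move=> Ux; rewrite -[X in is_derive X]fK//; apply: is_derive_inverse.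
  - by have := open_nbhs_nbhs (conj oV (UV _ Ux)); apply: filterS.
  - have := open_nbhs_nbhs (conj oV (UV _ Ux)); apply: filterS => y Vy.
    by apply: derivable1_continuous; exact: Cf.1.
  - by rewrite derive1E; apply: derivableP; exact/Cf.1/UV.
  - exact/f0/UV.
have {}dphi : (forall x, U x -> derivable phi x 1) /\
    forall x, U x -> (derive1 f (phi x) : R)^-1 = derive1 phi x.
  by split=> x /dphi[dx dE]; [exact: dx|rewrite [RHS]derive1E dE].
elim: n Cf => [|n IH] Cf.
  split; first exact: dphi.1.
  apply: (eq_Cn_open oU dphi.2) => x Ux; apply: cvgV; first exact/f0/UV.
  apply: continuous_comp; first exact/derivable1_continuous/dphi.1.
  exact/Cf.2/UV.
split; first exact: dphi.1.
apply: (eq_Cn_open oU dphi.2).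
apply: (@Cn_openV _ _ (derive1 f \o phi)) => //.
  by move=> x Ux; exact: (f0 _ (UV _ Ux)).
have [_ Cf1] := Cf; apply: (Cn_open_comp oU UV (IH (Cn_openW Cf)) Cf1).
Qed.

End Cn_open_theory.

(** On an open subset of [D], derivatives relative to [D] are ordinary ones. *)
Lemma Cn_on_interior (R : realType) (n : nat) (D U : set R) (f : R -> R) :
  open U -> U `<=` D -> Cn_on n D f -> Cn_open n U f.
Proof.
move=> oU UD.
have UDi x : U x -> D° x.
  by move=> Ux; apply: interiorS UD _ _; rewrite (interior_id _).1.
elim: n f => [|n IH] f [df cf].
  move=> x Ux; have := (subspace_continuousP _ f).1 cf x (UD _ Ux).
  by rewrite within_interior//; exact: UDi.
have dfx x : U x -> derivable f x 1.
  move=> Ux; apply: (derivable_on_interior f (UDi _ Ux)).1.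
  exact: (df 0%N isT x (UD _ Ux)).
split=> //; apply: (eq_Cn_open oU _ (IH (derive_on D f) _)).
  by move=> x Ux; rewrite derive_on_interior//; exact: UDi.
split.
  move=> k kn x Dx; have := df k.+1 kn x Dx.
  by rewrite /derive_onn iterSr.
by move: cf; rewrite /derive_onn iterSr.
Qed.

(** * The sign of the derivatives of the transferred function *)

(** Here [v] and [w] stand for phi_1' and phi_1'', while [G0], [d0] (resp.
    [G1], [d1]) stand for the values of g, g' at phi_0(x) (resp. phi_1(x)); the
    bounded quantity is (L g)'(x). *)
Lemma transfer_deriv_lt0 (R : realFieldType) (v w G0 G1 d0 d1 : R) :
  v < 0 -> 0 < 1 + 2 * v -> 0 < w - v ^+ 2 -> d0 < 0 -> d1 < 0 ->
  G0 < G1 -> G0 + d0 < G1 + d1 ->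
  w * (G0 - G1) + (1 + v) ^+ 2 * d0 - v ^+ 2 * d1 < 0.
Proof.
move=> v0 v1 w0 d00 d10 G01 Gd.
have A : 0 < (w - v ^+ 2) * (G1 - G0) by rewrite mulr_gt0// subr_gt0.
have v2 : 0 < v ^+ 2 by rewrite exprn_even_gt0//= lt_eqF.
have B : 0 < v ^+ 2 * (G1 + d1 - G0 - d0) by rewrite mulr_gt0//; lra.
have C : 0 < (1 + 2 * v) * - d0 by rewrite mulr_gt0//; lra.
rewrite [ltLHS](_ : _ = - ((w - v ^+ 2) * (G1 - G0) +
  v ^+ 2 * (G1 + d1 - G0 - d0) + (1 + 2 * v) * - d0)); last by ring.
by rewrite oppr_lt0 !addr_gt0.
Qed.

(** With, moreover, [z] standing for phi_1''' and [e0], [e1] for the values of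
    g'', the bounded quantity is (L g)''(x) + (L g)'(x). *)
Lemma transfer_deriv2_lt0 (R : realFieldType) (v w z G0 G1 d0 d1 e0 e1 : R) :
  v < 0 -> 0 < 1 + 2 * v -> 0 < w - v ^+ 2 ->
  (0 < z + w /\ 0 < 3 * w - v ^+ 2 + v) \/ 0 < z + w - v ^+ 2 ->
  d0 < 0 -> d1 < 0 -> e0 + d0 < 0 -> e1 + d1 < 0 ->
  G0 < G1 -> G0 + d0 < G1 + d1 ->
  z * (G0 - G1) + w * ((1 + v) * d0 - v * d1) +
  (2 * (1 + v) * w * d0 + (1 + v) ^+ 3 * e0 - (2 * v * w * d1 + v ^+ 3 * e1)) +
  (w * (G0 - G1) + (1 + v) ^+ 2 * d0 - v ^+ 2 * d1) < 0.
Proof.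
move=> v0 v1 w0 H d00 d10 e0d e1d G01 Gd.
have p0 : 0 < 1 + v by lra.
have E0 : 0 < (1 + v) ^+ 3 * - (e0 + d0) by rewrite mulr_gt0 ?exprn_gt0//; lra.
have E1 : 0 < (- v) ^+ 3 * - (e1 + d1) by rewrite mulr_gt0 ?exprn_gt0//; lra.
have v2 : 0 < v ^+ 2 by rewrite exprn_even_gt0//= lt_eqF.
have wp : 0 < w by lra.
case: H => [[zw H]|H].
- (* alternative (a): no comparison of G1 - G0 with d0 - d1 is needed *)
  have A1 : 0 < (z + w) * (G1 - G0) by rewrite mulr_gt0// subr_gt0.
  have A2 : 0 < (- v * (3 * w - v ^+ 2 + v)) * - d1.
    by rewrite !mulr_gt0// oppr_gt0.
  have A3 : 0 < ((1 + v) * (3 * w - v * (1 + v))) * - d0.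
    rewrite !mulr_gt0// ?oppr_gt0// addr_gt0 ?mulr_gt0//.
    by rewrite oppr_gt0 nmulr_rlt0.
  rewrite [ltLHS](_ : _ = - ((1 + v) ^+ 3 * - (e0 + d0) +
    (- v) ^+ 3 * - (e1 + d1) + (z + w) * (G1 - G0) +
    (- v * (3 * w - v ^+ 2 + v)) * - d1 +
    ((1 + v) * (3 * w - v * (1 + v))) * - d0)); last by ring.
  by rewrite oppr_lt0 !addr_gt0.
- (* alternative (b): use G1 - G0 > d0 - d1 and w > v ^+ 2 *)
  have A1 : 0 < (z + w - v ^+ 2) * (G1 - G0) by rewrite mulr_gt0// subr_gt0.
  have B : 0 < v ^+ 2 * (G1 + d1 - G0 - d0) by rewrite mulr_gt0//; lra.
  have A2 : 0 < (- v * (3 * (w - v ^+ 2) + 2 * v ^+ 2)) * - d1.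
    rewrite !mulr_gt0// ?oppr_gt0//; lra.
  have A3 : 0 < (3 * (1 + v) * (w - v ^+ 2) + - v * (1 - 2 * v ^+ 2)) * - d0.
    have : v ^+ 2 < 1 / 2 by nra.
    move=> ?; rewrite !mulr_gt0// ?oppr_gt0// addr_gt0 ?mulr_gt0//; lra.
  rewrite [ltLHS](_ : _ = - ((1 + v) ^+ 3 * - (e0 + d0) +
    (- v) ^+ 3 * - (e1 + d1) + (z + w - v ^+ 2) * (G1 - G0) +
    v ^+ 2 * (G1 + d1 - G0 - d0) +
    (- v * (3 * (w - v ^+ 2) + 2 * v ^+ 2)) * - d1 +
    (3 * (1 + v) * (w - v ^+ 2) + - v * (1 - 2 * v ^+ 2)) * - d0));
    last by ring.
  by rewrite oppr_lt0 !addr_gt0.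
Qed.

(** * Invariance of the class F for a single branch *)

Lemma is_derive_branches (R : realType) (p q a b g : R -> R)
    (x dp dq da db ga gb : R) :
  is_derive x 1 p dp -> is_derive x 1 q dq ->
  is_derive x 1 a da -> is_derive x 1 b db ->
  is_derive (a x) 1 g ga -> is_derive (b x) 1 g gb ->
  is_derive x 1 (fun y => p y * g (a y) - q y * g (b y))
    (dp * g (a x) + p x * (ga * da) - (dq * g (b x) + q x * (gb * db))).
Proof.
move=> Dp Dq Da Db Dga Dgb.
have D := is_deriveB (is_deriveM Dp (is_derive1_comp Dga Da))
                     (is_deriveM Dq (is_derive1_comp Dgb Db)).
apply: (is_derive_eq D).
rewrite /= [g (a x) *: _]mulrC [g (b x) *: _]mulrC.
by rewrite [X in X - _]addrC [X in _ - X]addrC.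
Qed.

Lemma Cn_open_is_derive (R : realType) (n : nat) (U : set R) (f : R -> R)
    (x : R) :
  Cn_open n.+1 U f -> U x -> is_derive x 1 f (derive1 f x).
Proof.
by move=> [df _] Ux; rewrite derive1E; apply: derivableP; exact: df.
Qed.

Lemma derive1_lt0_decr (R : realType) (f : R -> R) :
  (forall x, Rpos R x -> derivable f x 1) ->
  (forall x, Rpos R x -> (derive1 f x : R) < 0) ->
  forall x y, 0 < x -> x < y -> f y < f x.
Proof.
move=> df f0 x y x0 xy.
have P z : z \in `[x, y]%R -> Rpos R z.
  rewrite /Rpos/= !in_itv/= andbT => /andP[xz _]; exact: lt_le_trans xz.
have P' z : z \in `]x, y[%R -> Rpos R z.
  by move=> /subset_itv_oo_cc zxy; exact: P.
apply: (@ltr0_derive1_lt_cc R f x y) => //.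
- by move=> z /P' /df.
- by move=> z /P' /f0.
- by apply: derivable_within_continuous => z /P /df.
- by rewrite in_itv/= lexx ltW.
- by rewrite in_itv/= lexx ltW.
Qed.

Lemma open_Rpos (R : realType) : open (Rpos R).
Proof. exact: interval_open. Qed.

Lemma classF_C2 (R : realType) (g : R -> R) :
  classF R g -> Cn_open 2 (Rpos R) g.
Proof.
move=> Fg; split.
  by move=> x Ux; have [[dgx _ _] _] := Fg x Ux; exact: dgx.
split.
  by move=> x Ux; have [[_ ddgx _] _] := Fg x Ux; exact: ddgx.
by move=> x Ux; have [[_ _ cgx] _] := Fg x Ux; exact: cgx.
Qed.

(** The theorem once the transfer operator is written in terms of the
    decreasing inverse branch [phi] only, the other branch being
    x |-> x + phi x. *)
Lemma classF_transfer_branch (R : realType) (phi g : R -> R) :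
  Cn_open 3 (Rpos R) phi ->
  (forall x, Rpos R x -> 0 < phi x) ->
  (forall x, Rpos R x -> (derive1 phi x : R) < 0) ->
  (forall x, Rpos R x -> 0 < 1 + 2 * derive1 phi x) ->
  (forall x, Rpos R x -> 0 < derive1n 2 phi x - derive1 phi x ^+ 2) ->
  (forall x : R, Rpos R x ->
     (0 < derive1n 3 phi x + derive1n 2 phi x /\
      0 < 3 * derive1n 2 phi x - derive1 phi x ^+ 2 + derive1 phi x) \/
     0 < derive1n 3 phi x + derive1n 2 phi x - derive1 phi x ^+ 2) ->
  classF R g ->
  classF R (fun x => (1 + derive1 phi x) * g (x + phi x)
                     - derive1 phi x * g (phi x)).
Proof.
move=> C3 phi0 v0 H4i H4ii H4iii Fg.
pose U := Rpos R; have oU : open U := @open_Rpos R.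
pose v : R -> R := derive1 phi; pose w : R -> R := derive1 v.
pose z : R -> R := derive1 w; pose dg : R -> R := derive1 g.
pose a : R -> R := fun x => x + phi x.
set L := fun x => _.
have a0 x : U x -> U (a x).
  move=> Ux; rewrite /U /Rpos /= in_itv/= andbT addr_gt0//; last exact: phi0.
  by move: Ux; rewrite /U /Rpos/= in_itv/= andbT.
have b0 x : U x -> U (phi x) by move=> /phi0; rewrite /U/Rpos/= in_itv/= andbT.
have Cg : Cn_open 2 U g := classF_C2 Fg.
have Cdg : Cn_open 1 U dg by exact: Cg.2.
have Cv : Cn_open 2 U v by exact: C3.2.
have Cw : Cn_open 1 U w by exact: Cv.2.
have Ca : Cn_open 3 U a by exact: Cn_openD (Cn_open_id _ _) C3.
have Cp : Cn_open 2 U (fun x => 1 + v x).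
  exact: eq_Cn_open (Cn_openD oU (Cn_open_cst 2 U 1) Cv).
have CL : Cn_open 2 U L.
  have C1 := Cn_openM oU Cp (Cn_open_comp oU a0 (Cn_openW Ca) Cg).
  have C2 := Cn_openM oU Cv (Cn_open_comp oU b0 (Cn_openW C3) Cg).
  have C3' := Cn_openM oU (Cn_open_cst _ _ (- 1)) C2.
  apply: eq_Cn_open (Cn_openD oU C1 C3') => // x _.
  by rewrite /= mulN1r.
have Dphi x (Ux : U x) := Cn_open_is_derive C3 Ux.
have Dv x (Ux : U x) := Cn_open_is_derive Cv Ux.
have Dw x (Ux : U x) := Cn_open_is_derive Cw Ux.
have Dg x (Ux : U x) := Cn_open_is_derive Cg Ux.
have Ddg x (Ux : U x) := Cn_open_is_derive Cdg Ux.
have Da x : U x -> is_derive x 1 a (1 + v x).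
  by move=> Ux; exact: (is_deriveD (is_derive_id x 1) (Dphi x Ux)).
have Dp x : U x -> is_derive x 1 (fun x => 1 + v x) (w x).
  move=> Ux; have := is_deriveD (is_derive_cst (1 : R) x (1 : R)) (Dv x Ux).
  by rewrite add0r.
pose dL x := (w x * g (a x) - w x * g (phi x)) +
  ((1 + v x) ^+ 2 * dg (a x) - v x ^+ 2 * dg (phi x)).
have DL x : U x -> is_derive x 1 L (dL x).
  move=> Ux.
  apply: (is_derive_eq (is_derive_branches (Dp x Ux) (Dv x Ux) (Da x Ux)
    (Dphi x Ux) (Dg _ (a0 x Ux)) (Dg _ (b0 x Ux)))).
  by rewrite /dL -/dg -/(v x) -/(w x); ring.
have LdL x : U x -> dL x = derive1 L x.
  by move=> /DL[_ dE]; rewrite derive1E dE.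
have sq (f : R -> R) (x df : R) : is_derive x 1 f df ->
    is_derive x 1 (fun y => f y ^+ 2) (2 * f x * df).
  by move=> Df; exact: (is_derive_eq (is_deriveX 2 Df)).
have DdL x : U x -> derive1 dL x =
  z x * (g (a x) - g (phi x)) +
  w x * ((1 + v x) * dg (a x) - v x * dg (phi x)) +
  (2 * (1 + v x) * w x * dg (a x) + (1 + v x) ^+ 3 * derive1 dg (a x) -
  (2 * v x * w x * dg (phi x) + v x ^+ 3 * derive1 dg (phi x))).
  move=> Ux.
  have D1 := is_derive_branches (Dw x Ux) (Dw x Ux) (Da x Ux)
    (Dphi x Ux) (Dg _ (a0 x Ux)) (Dg _ (b0 x Ux)).
  have D2 := is_derive_branches (sq _ _ _ (Dp x Ux)) (sq _ _ _ (Dv x Ux))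
    (Da x Ux) (Dphi x Ux) (Ddg _ (a0 x Ux)) (Ddg _ (b0 x Ux)).
  have [_ dE] := is_deriveD D1 D2.
  rewrite derive1E.
  apply: (etrans dE).
  rewrite -/dg -/(v x) -/(w x) -/(z x).
  by move: (v x) (w x) (z x) (g (a x)) (g (phi x)) (dg (a x)) (dg (phi x))
    (derive1 dg (a x)) (derive1 dg (phi x)) => *; ring.
have d2L x : U x -> derive1 dL x = derive1 (derive1 L) x.
  exact: eq_derive1_open.
have gE x : U x -> [/\ 0 < g x, dg x < 0 & derive1 dg x + dg x < 0].
  by move=> /Fg[].
have gdec : forall x y, 0 < x -> x < y -> g y < g x.
  by apply: derive1_lt0_decr; [exact: Cg.1|move=> x /gE[]].
(* g'' + g' < 0 makes g + g' decreasing *)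
have gddec : forall x y, 0 < x -> x < y -> g y + dg y < g x + dg x.
  apply: derive1_lt0_decr => x Ux.
    by apply: derivableD; [exact: Cg.1|exact: Cdg.1].
  rewrite derive1E deriveD; [|exact: Cg.1|exact: Cdg.1].
  rewrite -!derive1E addrC; by have [] := gE x Ux.
have pa x : U x -> phi x < a x.
  by rewrite /U/Rpos/= in_itv/= andbT /a ltrDr.
move=> x Ux; split.
  by split; [exact: CL.1|exact: CL.2.1|exact: CL.2.2].
have [ga dga ddga] := gE _ (a0 x Ux); have [gb dgb ddgb] := gE _ (b0 x Ux).
have v0x : v x < 0 := v0 x Ux.
have ix : 0 < 1 + 2 * v x := H4i x Ux.
have p0x : 0 < 1 + v x.
  by apply: lt_trans ix _; rewrite ltrD2l mulr_natl mulr2n gtrDl.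
split.
- rewrite /L subr_gt0; apply: (@lt_trans _ _ 0); first by rewrite nmulr_rlt0.
  exact: mulr_gt0 p0x ga.
- rewrite -LdL// /dL addrA -mulrBr.
  apply: transfer_deriv_lt0 => //; first exact: H4ii.
    exact: gdec (phi0 _ Ux) (pa _ Ux).
  exact: gddec (phi0 _ Ux) (pa _ Ux).
- rewrite -[derive1n 2 L x]/(derive1 (derive1 L) x) -d2L// DdL// -LdL// /dL.
  rewrite -mulrBr [X in _ + X]addrA.
  apply: transfer_deriv2_lt0 => //; [exact: H4ii|exact: H4iii| |].
    exact: gdec (phi0 _ Ux) (pa _ Ux).
  exact: gddec (phi0 _ Ux) (pa _ Ux).
Qed.

(** * The inverse branches *)

Lemma derivable_on_subitv (R : realType) (i : interval R) (f : R -> R)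
    (x y : R) :
  (forall t, [set` i] t -> derivable_on [set` i] f t) -> x \in i -> y \in i ->
  {within `[x, y], continuous f} /\
  forall t, t \in `]x, y[ -> [/\ [set` i] t, derivable f t 1
    & derive1 f t = derive_on [set` i] f t].
Proof.
move=> df xi yi.
have sub : [set` `[x, y]] `<=` [set` i].
  move=> t /=; rewrite in_itv/=; exact: (interval_is_interval xi yi).
split.
  by apply: continuous_subspaceW sub _; exact: derivable_on_continuous.
move=> t txy; have int : [set` i]° t.
  apply: (@interiorS _ [set` `]x, y[]).
    by move=> u /= /subset_itv_oo_cc /sub.
  by rewrite (interior_id _).1//; exact: interval_open.
have it := interior_subset int.
split=> //; last by rewrite derive_on_interior.
by apply: (derivable_on_interior f int).1; exact: df.
Qed.

Lemma derive_on_lt0_decr (R : realType) (i : interval R) (f : R -> R) :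
  (forall x, [set` i] x -> derivable_on [set` i] f x) ->
  (forall x, [set` i] x -> derive_on [set` i] f x < 0) ->
  {in i &, forall x y, x < y -> f y < f x}.
Proof.
move=> df f0 x y xi yi xy; have [cf dfi] := derivable_on_subitv df xi yi.
apply: (@ltr0_derive1_lt_cc R f x y) => //.
- by move=> t /dfi[].
- by move=> t /dfi[it _ ->]; exact: f0.
- by rewrite in_itv/= lexx ltW.
- by rewrite in_itv/= lexx ltW.
Qed.

Lemma derive_on_gt0_incr (R : realType) (i : interval R) (f : R -> R) :
  (forall x, [set` i] x -> derivable_on [set` i] f x) ->
  (forall x, [set` i] x -> 0 < derive_on [set` i] f x) ->
  {in i &, forall x y, x < y -> f x < f y}.
Proof.
move=> df f0 x y xi yi xy; have [cf dfi] := derivable_on_subitv df xi yi.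
apply: (@gtr0_derive1_lt_cc R f x y) => //.
- by move=> t /dfi[].
- by move=> t /dfi[it _ ->]; exact: f0.
- by rewrite in_itv/= lexx ltW.
- by rewrite in_itv/= lexx ltW.
Qed.

Lemma pinv_image (T U : pointedType) (A : set T) (B : set U) (f : T -> U)
    (x : U) :
  f @` A = B -> B x -> A (pinv A f x) /\ f (pinv A f x) = x.
Proof.
move=> fAB Bx; split; last by apply: pinvK; rewrite inE fAB.
apply: (surjpinv_image_sub (A := A) (f := f) (B := B)); last by exists x.
by rewrite /set_surj fAB.
Qed.

(** The preimage of [0, x] is the segment from phi_1(x) to phi_0(x), and it has
    the same length as [0, x]. *)
Lemma phi0_eq_add_phi1 (R : realType) (a : R) (S : R -> R) :
  {in `[a, +oo[ &, forall x y, x < y -> S x < S y} ->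
  {in `]0, a] &, forall x y, x < y -> S y < S x} ->
  (forall x : R, Rpos R x -> Rnneg R (S x)) ->
  S @` I0 a = Rnneg R -> S @` I1 a = Rnneg R ->
  preserves_lebesgue S ->
  forall x, 0 < x -> phi0 a S x = x + phi1 a S x.
Proof.
move=> inc dec Snn im0 im1 H3 x x0.
have xnn : Rnneg R x by rewrite /Rnneg/= in_itv/= ltW.
have [I0x S0x] := pinv_image im0 xnn; rewrite -/(phi0 a S) in I0x S0x.
have [I1x S1x] := pinv_image im1 xnn; rewrite -/(phi1 a S) in I1x S1x.
set p := phi0 a S x in I0x S0x *; set q := phi1 a S x in I1x S1x *.
move: (I0x) (I1x); rewrite /I0/I1/= !in_itv/= andbT => ap /andP[q0 qa].
have preim : Rpos R `&` S @^-1` `[0, x]%classic = `[q, p]%classic.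
  apply/seteqP; split=> y /=.
    rewrite /Rpos/= !in_itv/= andbT => -[y0 /andP[_ Syx]].
    apply/andP; split.
      rewrite leNgt; apply/negP => yq.
      have := dec y q; rewrite !in_itv/= y0 q0 qa (ltW (lt_le_trans yq qa)).
      by move=> /(_ isT isT yq); rewrite S1x ltNge Syx.
    rewrite leNgt; apply/negP => py.
    have := inc p y; rewrite !in_itv/= !andbT ap (ltW (le_lt_trans ap py)).
    by move=> /(_ isT isT py); rewrite S0x ltNge Syx.
  rewrite !in_itv/= => /andP[qy yp].
  have y0 : 0 < y := lt_le_trans q0 qy.
  split; first by rewrite /Rpos/= in_itv/= y0.
  have := Snn y; rewrite /Rpos /Rnneg /= !in_itv/= y0 !andbT => /(_ isT) -> /=.
  have [ya|ay] := leP y a.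
    move: qy; rewrite le_eqVlt => /predU1P[<-|qy]; first by rewrite S1x.
    rewrite ltW// -S1x; apply: dec; rewrite ?in_itv/= ?q0 ?qa ?y0 ?ya//.
  move: yp; rewrite le_eqVlt => /predU1P[->|yp]; first by rewrite S0x.
  rewrite ltW// -S0x; apply: inc; rewrite ?in_itv/= ?andbT ?(ltW ay)//.
have := H3 `[0, x]%classic; rewrite preim => /(_ (measurable_itv _)).
have sub : `[0, x]%classic `<=` Rnneg R.
  by move=> y; rewrite /Rnneg/= !in_itv/= andbT => /andP[].
move=> /(_ sub); rewrite !lebesgue_measure_itv/= !lte_fin x0.
case: ifPn => [qp|]; last first.
  by move=> _ /eqP; rewrite -EFinB eqe eq_sym subr0 gt_eqF.
by rewrite -!EFinB => -[] /eqP; rewrite subr0 subr_eq => /eqP.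
Qed.

Theorem theorem17 (R : realType) (a : R) (S : R -> R)
  (a_gt0 : 0 < a)
  (S_dom : forall x : R, Rpos R x -> Rnneg R (S x))
  (S_C3 : Cn_on 3 (I0 a) S /\ Cn_on 3 (I1 a) S)
  (H1 : S @` I0 a = Rnneg R /\ S @` I1 a = Rnneg R)
  (H2 : [/\ forall x : R, I0 a x -> 1 < derive_on (I0 a) S x,
            derive_on (I0 a) S x @[x --> +oo] --> (1 : R)
          & forall x : R, I1 a x -> derive_on (I1 a) S x < -1])
  (H3 : preserves_lebesgue S)
  (H4i : forall x : R, Rpos R x -> 0 < 1 + 2 * derive1 (phi1 a S) x)
  (H4ii : forall x : R, Rpos R x ->
     0 < derive1n 2 (phi1 a S) x - derive1 (phi1 a S) x ^+ 2)
  (H4iii : forall x : R, Rpos R x ->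
     (0 < derive1n 3 (phi1 a S) x + derive1n 2 (phi1 a S) x /\
      0 < 3 * derive1n 2 (phi1 a S) x - derive1 (phi1 a S) x ^+ 2 + derive1 (phi1 a S) x) \/
     0 < derive1n 3 (phi1 a S) x + derive1n 2 (phi1 a S) x - derive1 (phi1 a S) x ^+ 2) :
  transfer a S @` classF R `<=` classF R.
Proof.
move=> _ [g Fg <-].
have [im0 im1] := H1; have [S0 _ S1] := H2; have [C0 C1] := S_C3.
have inc : {in `[a, +oo[ &, forall x y, x < y -> S x < S y}.
  apply: derive_on_gt0_incr => x; first exact: (C0.1 0%N).
  by move=> /S0; exact: lt_trans.
have dec : {in `]0, a] &, forall x y, x < y -> S y < S x}.
  apply: derive_on_lt0_decr => x; first exact: (C1.1 0%N).
  by move=> /S1 /lt_trans; apply; rewrite oppr_lt0.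
have phi01 := phi0_eq_add_phi1 inc dec S_dom im0 im1 H3.
set phi := phi1 a S in H4i H4ii H4iii phi01.
have RposE x : Rpos R x = (0 < x) :> Prop by rewrite /Rpos/= in_itv/= andbT.
pose V : set R := `]0, a[%classic.
have VI : V `<=` I1 a by move=> y; rewrite /V /I1/= !in_itv/= => /andP[-> /ltW].
have oV : open V by exact: interval_open.
have I1phi x : Rnneg R x -> I1 a (phi x) by case/(pinv_image im1).
have phiK x : Rnneg R x -> S (phi x) = x by case/(pinv_image im1).
have inj : {in I1 a &, injective S}.
  move=> x y; rewrite !inE => xi yi Sxy.
  have [xy|xy|//] := ltgtP x y.
    by have := dec _ _ xi yi xy; rewrite Sxy ltxx.
  by have := dec _ _ yi xi xy; rewrite Sxy ltxx.
have SK y : I1 a y -> phi (S y) = y.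
  by move=> yi; apply: pinvKV => //; rewrite inE.
(* S a is the least value of S on I1, and 0 is attained there *)
have Sa : S a = 0.
  have [z zi Sz] : (S @` I1 a) 0 by rewrite im1 /Rnneg/= in_itv/= lexx.
  have ai : I1 a a by rewrite /I1/= in_itv/= a_gt0 lexx.
  have := S_dom a; rewrite RposE a_gt0 /Rnneg/= in_itv/= andbT => /(_ isT) Sa0.
  move: (zi); rewrite /I1/= in_itv/= => /andP[_].
  rewrite le_eqVlt => /predU1P[<-//|za].
  by have := dec _ _ zi ai za; rewrite Sz ltNge Sa0.
have UV x : Rpos R x -> V (phi x).
  rewrite RposE => x0; have xnn : Rnneg R x by rewrite /Rnneg/= in_itv/= ltW.
  have := I1phi x xnn; rewrite /I1 /V /= !in_itv/= => /andP[-> /=].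
  rewrite le_eqVlt => /predU1P[pa|//].
  by have := phiK x xnn; rewrite pa Sa => x0'; rewrite -x0' ltxx in x0.
have PN x : Rpos R x -> Rnneg R x.
  by rewrite RposE /Rnneg/= in_itv/= andbT => /ltW.
have VU y : V y -> Rpos R (S y).
  rewrite RposE => Vy; rewrite -Sa; apply: dec; first exact: VI.
    by rewrite in_itv/= a_gt0 lexx.
  by move: Vy; rewrite /V/= in_itv/= => /andP[].
have CS : Cn_open 3 V S by exact: Cn_on_interior C1.
have dS y : V y -> (derive1 S y : R) < -1.
  move=> Vy; rewrite -(@derive_on_interior _ (I1 a)).
    exact/S1/VI.
  by apply: (interiorS VI); rewrite (interior_id _).1.
have Cphi : Cn_open 3 (Rpos R) phi.
  apply: (Cn_open_inverse (open_Rpos (R:=R)) oV UV _ _ VU _ CS).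
  - by move=> x /PN/phiK.
  - by move=> y /VI/SK.
  - by move=> y /dS Sy; rewrite lt_eqF// (lt_trans Sy)// oppr_lt0.
(* differentiate S (phi x) = x *)
have phi_lt0 x : Rpos R x -> (derive1 phi x : R) < 0.
  move=> Ux; have Vx := UV x Ux.
  have D := is_derive1_comp (Cn_open_is_derive CS Vx)
    (Cn_open_is_derive Cphi Ux).
  have [_ D1] : is_derive x 1 (S \o phi) 1.
    apply: near_eq_is_derive (is_derive_id x 1).
    have := open_nbhs_nbhs (conj (open_Rpos (R:=R)) Ux).
    apply: filterS => y /PN Uy.
    by rewrite /= phiK.
  case: D => _; rewrite D1 => E.
  have S'0 : (derive1 S (phi x) : R) < 0.
    by rewrite (lt_trans (dS _ Vx))// oppr_lt0.
  by rewrite -(nmulr_rgt0 _ S'0) -E.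
have phi_gt0 x : Rpos R x -> 0 < phi x.
  by move=> /UV; rewrite /V/= in_itv/= => /andP[].
have FL := classF_transfer_branch Cphi phi_gt0 phi_lt0 H4i H4ii H4iii Fg.
set L := (X in classF R X) in FL.
have phi01' x : Rpos R x -> derive1 (phi0 a S) x = 1 + derive1 phi x.
  move=> Ux; rewrite (eq_derive1_open (open_Rpos (R:=R)) (g := id \+ phi) _ Ux).
    by rewrite !derive1E deriveD ?derive_id//; exact: Cphi.1.
  by move=> y; rewrite RposE; exact: phi01.
have LE x : Rpos R x -> L x = transfer a S g x.
  by move=> Ux; rewrite /L /transfer phi01'// phi01// -RposE.
have d1 x : Rpos R x -> derive1 L x = derive1 (transfer a S g) x.
  exact: (eq_derive1_open (open_Rpos (R:=R)) LE).
have d2 x : Rpos R x -> derive1n 2 L x = derive1n 2 (transfer a S g) x.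
  exact: (eq_derive1_open (open_Rpos (R:=R)) d1).
have CT := eq_Cn_open (open_Rpos (R:=R)) LE (classF_C2 FL).
move=> x Ux; split; first by split; [exact: CT.1|exact: CT.2.1|exact: CT.2.2].
by rewrite -(LE x Ux) -(d1 x Ux) -(d2 x Ux); have [_] := FL x Ux.
Qed.
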